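(* Let $Q$ be the two loops quiver, with one vertex $e$ and two loops $a$ and $b$, and let $A:=\mathbb{C}Q/\langle Q_2\rangle$. Then the elements $$H:=(b,b)-(a,a),\qquad E:=(a,b),\qquad F:=(b,a)$$ generate a copy of the Lie algebra $sl_2(\mathbb{C})$ in $HH^1(A)$. Moreover, the Lie algebra $HH^1(A)$ is isomorphic to $sl_2(\mathbb{C})\times\mathbb{C}$.
   Context: $\langle Q_2\rangle$ is the two-sided ideal of the path algebra generated by the paths of length two, so $A$ has basis $e=1,a,b$ with the product of any two arrows equal to zero. $HH^1(A)$ carries the Gerstenhaber (commutator) Lie bracket. It is identified with the vector space $\mathbb{C}(Q_1\parallel Q_1)$ with basis the pairs $(x,y)$, $x,y\in\{a,b\}$: the pair $(x,y)$ corresponds to the (class of the) derivation of $A$ sending the arrow $x$ to $y$ and the other arrow to $0$. Under this identification the bracket is $[(x,y),(z,w)]=\delta_{w,x}(z,y)-\delta_{y,z}(x,w)$, with $\delta$ the Kronecker delta. *)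

(* Defs.v *)
From HB Require Import structures.
From mathcomp Require Import all_boot all_order all_algebra.
From mathcomp Require Import boolp classical_sets functions reals.
From mathcomp Require Import complex monalg.

Set Implicit Arguments.
Unset Strict Implicit.
Unset Printing Implicit Defensive.

Import GRing.Theory.
Local Open Scope classical_set_scope.
Local Open Scope ring_scope.
Local Open Scope quotient_scope.

Reserved Notation "[lie x , y ]" (format "[lie  x ,  y ]").

Lemma jacobi_cancel (V : zmodType) (a b c d e f : V) :
  a - b - (c - d) + (c - e - (f - b)) + (f - d - (a - e)) = 0.
Proof.
rewrite !opprB !addrA (ACl (1*12*2*7*3*10*4*5*6*11*8*9))%AC /=.
by rewrite subrr add0r !subrK addNr add0r subrr.
Qed.

HB.mixin Record Lmodule_isLie (K : comNzRingType) L of GRing.Lmodule K L := {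
  lie : L -> L -> L;
  lie_linearl : forall k x y z,
    lie (k *: x + y) z = k *: lie x z + lie y z;
  lie_linearr : forall k x y z,
    lie z (k *: x + y) = k *: lie z x + lie z y;
  lie_xx : forall x, lie x x = 0;
  lie_jacobi : forall x y z,
    lie x (lie y z) + lie y (lie z x) + lie z (lie x y) = 0
}.

#[short(type="lieAlgType")]
HB.structure Definition LieAlgebra (K : comNzRingType) :=
  {L of GRing.Lmodule K L & Lmodule_isLie K L}.

Notation "[lie x , y ]" := (lie x y) : ring_scope.

Definition lie_morphism (K : comNzRingType) (L1 L2 : lieAlgType K)
    (f : L1 -> L2) : Prop :=
  linear f /\ {morph f : x y / [lie x, y]}.

Definition lie_isomorphic (K : comNzRingType) (L1 L2 : lieAlgType K) : Prop :=
  exists f : L1 -> L2, lie_morphism f /\ bijective f.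

Definition lie_subalgebra (K : comNzRingType) (L : lieAlgType K)
    (S : set L) : Prop :=
  [/\ S 0, forall k x y, S x -> S y -> S (k *: x + y)
    & forall x y, S x -> S y -> S [lie x, y]].

Definition lie_generated (K : comNzRingType) (L : lieAlgType K) (X : set L) :
  set L := smallest (@lie_subalgebra K L) X.

Section LieProduct.
Variables (K : comNzRingType) (L1 L2 : lieAlgType K).

Definition pair_lie (x y : L1 * L2) : L1 * L2 :=
  ([lie x.1, y.1], [lie x.2, y.2]).

Fact pair_lie_linearl k x y z :
  pair_lie (k *: x + y) z = k *: pair_lie x z + pair_lie y z.
Proof. by congr pair; rewrite /= lie_linearl. Qed.

Fact pair_lie_linearr k x y z :
  pair_lie z (k *: x + y) = k *: pair_lie z x + pair_lie z y.
Proof. by congr pair; rewrite /= lie_linearr. Qed.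

Fact pair_lie_xx x : pair_lie x x = 0.
Proof. by congr pair; rewrite /= lie_xx. Qed.

Fact pair_lie_jacobi x y z :
  pair_lie x (pair_lie y z) + pair_lie y (pair_lie z x)
    + pair_lie z (pair_lie x y) = 0.
Proof. by congr pair; rewrite /= lie_jacobi. Qed.

HB.instance Definition _ := Lmodule_isLie.Build K (L1 * L2)%type
  pair_lie_linearl pair_lie_linearr pair_lie_xx pair_lie_jacobi.
End LieProduct.

Section AbelianLie.
Variable K : comNzRingType.

Definition abelian_lie (V : Type) : Type := V.
HB.instance Definition _ (V : lmodType K) :=
  GRing.Lmodule.on (abelian_lie V).

Variable V : lmodType K.
Let bracket (x y : abelian_lie V) : abelian_lie V := 0.

Fact abelian_lie_linearl k x y z :
  bracket (k *: x + y) z = k *: bracket x z + bracket y z.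
Proof. by rewrite scaler0 addr0. Qed.

Fact abelian_lie_linearr k x y z :
  bracket z (k *: x + y) = k *: bracket z x + bracket z y.
Proof. by rewrite scaler0 addr0. Qed.

Fact abelian_lie_xx x : bracket x x = 0. Proof. by []. Qed.

Fact abelian_lie_jacobi x y z :
  bracket x (bracket y z) + bracket y (bracket z x)
    + bracket z (bracket x y) = 0.
Proof. by rewrite !addr0. Qed.

HB.instance Definition _ := Lmodule_isLie.Build K (abelian_lie V)
  abelian_lie_linearl abelian_lie_linearr abelian_lie_xx abelian_lie_jacobi.
End AbelianLie.

Section SpecialLinear.
Variables (K : comNzRingType) (n : nat).

Definition traceless : {pred 'M[K]_n} := fun M => \tr M == 0.

Fact traceless_submod_closed : submod_closed traceless.
Proof.
split=> [|k M N]; rewrite !unfold_in ?mxtrace0 //.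
by move=> /eqP trM /eqP trN; rewrite mxtraceD mxtraceZ trM trN mulr0 addr0.
Qed.

HB.instance Definition _ :=
  GRing.isSubmodClosed.Build K 'M[K]_n traceless traceless_submod_closed.

Record sl : Type := Sl { sl_mx :> 'M[K]_n; sl_mxP : sl_mx \in traceless }.

HB.instance Definition _ := [isSub for sl_mx].
HB.instance Definition _ := [Choice of sl by <:].
HB.instance Definition _ := [SubChoice_isSubLmodule of sl by <:].

Fact sl_lie_subproof (M N : sl) :
  sl_mx M *m sl_mx N - sl_mx N *m sl_mx M \in traceless.
Proof. by rewrite unfold_in mxtraceD raddfN /= mxtrace_mulC subrr. Qed.

Definition sl_lie (M N : sl) : sl := Sl (sl_lie_subproof M N).

Fact sl_lie_linearl k (x y z : sl) :
  sl_lie (k *: x + y) z = k *: sl_lie x z + sl_lie y z.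
Proof.
apply: val_inj; rewrite /= mulmxDl mulmxDr -scalemxAl -scalemxAr.
by rewrite scalerBr opprD addrACA.
Qed.

Fact sl_lie_linearr k (x y z : sl) :
  sl_lie z (k *: x + y) = k *: sl_lie z x + sl_lie z y.
Proof.
apply: val_inj; rewrite /= mulmxDl mulmxDr -scalemxAl -scalemxAr.
by rewrite scalerBr opprD addrACA.
Qed.

Fact sl_lie_xx (x : sl) : sl_lie x x = 0.
Proof. by apply: val_inj; rewrite /= subrr. Qed.

Fact sl_lie_jacobi (x y z : sl) :
  sl_lie x (sl_lie y z) + sl_lie y (sl_lie z x) + sl_lie z (sl_lie x y) = 0.
Proof.
apply: val_inj; rewrite /= !(mulmxBl, mulmxBr) !mulmxA.
exact: jacobi_cancel.
Qed.

HB.instance Definition _ := Lmodule_isLie.Build K sl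
  sl_lie_linearl sl_lie_linearr sl_lie_xx sl_lie_jacobi.
End SpecialLinear.

Section LmoduleQuotient.
Variables (K : pzRingType) (V : lmodType K) (I : submodClosed V).

(* A submodClosed predicate is not canonically closed under opposite, which
   the quotient of Z-modules requires. *)
Definition submod_pred : {pred V} := I.

Fact submod_zmod_closed : zmod_closed submod_pred.
Proof. exact: (GRing.submod_closedB (submodClosedP I)). Qed.

HB.instance Definition _ :=
  GRing.isZmodClosed.Build V submod_pred submod_zmod_closed.

Definition lmod_quot : Type := Quotient.quot submod_pred.
HB.instance Definition _ := GRing.Zmodule.on lmod_quot.
HB.instance Definition _ := EqQuotient.on lmod_quot.

Definition lmod_pi (x : V) : lmod_quot := \pi x.

Lemma lmod_piP (x y : V) : (lmod_pi x = lmod_pi y) <-> (x - y \in I).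
Proof.
by rewrite (Quotient.idealrBE submod_pred); split=> [?|/eqP//]; exact/eqP.
Qed.

Lemma lmod_reprK (q : lmod_quot) : lmod_pi (repr q) = q.
Proof. exact: reprK. Qed.

Lemma lmod_piB : {morph lmod_pi : x y / x - y}.
Proof. by move=> x y; rewrite /lmod_pi !piE. Qed.
HB.instance Definition _ :=
  GRing.isZmodMorphism.Build V lmod_quot lmod_pi lmod_piB.

Definition lquot_scale (k : K) (q : lmod_quot) : lmod_quot :=
  lmod_pi (k *: repr q).

Lemma lmod_piZ k x : lquot_scale k (lmod_pi x) = lmod_pi (k *: x).
Proof.
by apply/lmod_piP; rewrite -scalerBr rpredZ //; apply/lmod_piP/lmod_reprK.
Qed.

Fact lquot_scaleA j k q :
  lquot_scale j (lquot_scale k q) = lquot_scale (j * k) q.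
Proof. by rewrite -[q]lmod_reprK !lmod_piZ scalerA. Qed.

Fact lquot_scale1 : left_id 1 lquot_scale.
Proof. by move=> q; rewrite -[q]lmod_reprK lmod_piZ scale1r. Qed.

Fact lquot_scaleDr : right_distributive lquot_scale +%R.
Proof.
move=> k p q; rewrite -[p]lmod_reprK -[q]lmod_reprK -raddfD !lmod_piZ.
by rewrite scalerDr raddfD.
Qed.

Fact lquot_scaleDl q : {morph lquot_scale^~ q : j k / j + k}.
Proof.
by move=> j k; rewrite -[q]lmod_reprK !lmod_piZ scalerDl raddfD.
Qed.

HB.instance Definition _ := GRing.Zmodule_isLmodule.Build K lmod_quot
  lquot_scaleA lquot_scale1 lquot_scaleDr lquot_scaleDl.

Fact lmod_pi_scalable : scalable lmod_pi.
Proof. by move=> k x; rewrite -lmod_piZ. Qed.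
HB.instance Definition _ :=
  GRing.isScalable.Build K V lmod_quot *:%R lmod_pi lmod_pi_scalable.
End LmoduleQuotient.

(* Properness is needed for the quotient to be a (nonzero) algType. *)
HB.mixin Record isTwoSidedProperIdeal (K : comNzRingType) (A : algType K)
    (S : A -> bool) := {
  twosided1N : S 1 = false;
  twosidedMl : forall a x, S x -> S (a * x);
  twosidedMr : forall a x, S x -> S (x * a)
}.

#[short(type="properIdeal")]
HB.structure Definition TwoSidedProperIdeal (K : comNzRingType)
    (A : algType K) :=
  {S of GRing.AddClosed A S & GRing.isScaleClosed K A S &
   isTwoSidedProperIdeal K A S}.

Section AlgebraQuotient.
Variables (K : comNzRingType) (A : algType K) (I : properIdeal A).

Definition alg_quot : Type := lmod_quot I.
HB.instance Definition _ := GRing.Lmodule.on alg_quot.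

Definition alg_pi (x : A) : alg_quot := lmod_pi I x.
Fact alg_pi_linear : linear alg_pi.
Proof. exact: (linearP (lmod_pi I)). Qed.
HB.instance Definition _ :=
  GRing.isLinear.Build K A alg_quot *:%R alg_pi alg_pi_linear.

Definition alg_lift (q : alg_quot) : A := repr (q : lmod_quot I).

Lemma alg_piP (x y : A) : (alg_pi x = alg_pi y) <-> (x - y \in I).
Proof. exact: lmod_piP. Qed.

Lemma alg_liftK (q : alg_quot) : alg_pi (alg_lift q) = q.
Proof. exact: lmod_reprK. Qed.

Definition aquot_mul (p q : alg_quot) : alg_quot :=
  alg_pi (alg_lift p * alg_lift q).

Lemma alg_piM x y : aquot_mul (alg_pi x) (alg_pi y) = alg_pi (x * y).
Proof.
apply/alg_piP; set x' := alg_lift _; set y' := alg_lift _.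
have -> : x' * y' - x * y = (x' - x) * y' + x * (y' - y).
  by rewrite mulrBl mulrBr addrA subrK.
apply: rpredD; [apply: twosidedMr | apply: twosidedMl];
  exact/alg_piP/alg_liftK.
Qed.

Fact aquot_mulA : associative aquot_mul.
Proof.
move=> p q r; rewrite -[p]alg_liftK -[q]alg_liftK -[r]alg_liftK.
by rewrite !alg_piM mulrA.
Qed.

Fact aquot_mul1l : left_id (alg_pi 1) aquot_mul.
Proof. by move=> p; rewrite -[p]alg_liftK alg_piM mul1r. Qed.

Fact aquot_mul1r : right_id (alg_pi 1) aquot_mul.
Proof. by move=> p; rewrite -[p]alg_liftK alg_piM mulr1. Qed.

Fact aquot_mulDl : left_distributive aquot_mul +%R.
Proof.
move=> p q r; rewrite -[p]alg_liftK -[q]alg_liftK -[r]alg_liftK.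
by rewrite -raddfD !alg_piM mulrDl raddfD.
Qed.

Fact aquot_mulDr : right_distributive aquot_mul +%R.
Proof.
move=> p q r; rewrite -[p]alg_liftK -[q]alg_liftK -[r]alg_liftK.
by rewrite -raddfD !alg_piM mulrDr raddfD.
Qed.

Fact aquot_1neq0 : alg_pi 1 != 0.
Proof.
apply/eqP => /eqP; rewrite -(raddf0 alg_pi) => /eqP/alg_piP.
by rewrite subr0 -topredE /= twosided1N.
Qed.

HB.instance Definition _ := GRing.Zmodule_isNzRing.Build alg_quot
  aquot_mulA aquot_mul1l aquot_mul1r aquot_mulDl aquot_mulDr aquot_1neq0.

Fact alg_pi_monoid_morphism : monoid_morphism alg_pi.
Proof. by split=> // x y; rewrite -alg_piM. Qed.
HB.instance Definition _ := GRing.isMonoidMorphism.Build A alg_quot alg_pi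
  alg_pi_monoid_morphism.
Let alg_piE x y : alg_pi x * alg_pi y = alg_pi (x * y).
Proof. by rewrite rmorphM. Qed.

Let alg_piZ (k : K) x : k *: alg_pi x = alg_pi (k *: x).
Proof. by rewrite linearZ. Qed.

Fact aquot_scalerAl (k : K) (p q : alg_quot) : k *: (p * q) = (k *: p) * q.
Proof.
rewrite -[p]alg_liftK -[q]alg_liftK.
by rewrite !(alg_piE, alg_piZ) scalerAl.
Qed.

HB.instance Definition _ :=
  GRing.Lmodule_isLalgebra.Build K alg_quot aquot_scalerAl.

Fact aquot_scalerAr (k : K) (p q : alg_quot) : k *: (p * q) = p * (k *: q).
Proof.
rewrite -[p]alg_liftK -[q]alg_liftK.
by rewrite !(alg_piE, alg_piZ) scalerAr.
Qed.

HB.instance Definition _ :=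
  GRing.Lalgebra_isAlgebra.Build K alg_quot aquot_scalerAr.

End AlgebraQuotient.

HB.mixin Record isLieIdeal (K : comNzRingType) (L : lieAlgType K)
    (S : L -> bool) := {
  lie_ideall : forall x y, S x -> S [lie x, y];
  lie_idealr : forall x y, S y -> S [lie x, y]
}.

#[short(type="lieIdeal")]
HB.structure Definition LieIdeal (K : comNzRingType) (L : lieAlgType K) :=
  {S of GRing.AddClosed L S & GRing.isScaleClosed K L S & isLieIdeal K L S}.

Section LieQuotient.
Variables (K : comNzRingType) (L : lieAlgType K) (I : lieIdeal L).

Definition lie_quot : Type := lmod_quot I.
HB.instance Definition _ := GRing.Lmodule.on lie_quot.

Definition lie_pi (x : L) : lie_quot := lmod_pi I x.
Fact lie_pi_linear : linear lie_pi.
Proof. exact: (linearP (lmod_pi I)). Qed.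
HB.instance Definition _ :=
  GRing.isLinear.Build K L lie_quot *:%R lie_pi lie_pi_linear.

Definition lie_lift (q : lie_quot) : L := repr (q : lmod_quot I).

Lemma lie_piP (x y : L) : (lie_pi x = lie_pi y) <-> (x - y \in I).
Proof. exact: lmod_piP. Qed.

Lemma lie_liftK (q : lie_quot) : lie_pi (lie_lift q) = q.
Proof. exact: lmod_reprK. Qed.

Definition lquot_lie (p q : lie_quot) : lie_quot :=
  lie_pi [lie lie_lift p, lie_lift q].

Lemma lie_pi_lie x y : lquot_lie (lie_pi x) (lie_pi y) = lie_pi [lie x, y].
Proof.
apply/lie_piP; set x' := lie_lift _; set y' := lie_lift _.
have -> : [lie x', y'] - [lie x, y] = [lie x' - x, y'] + [lie x, y' - y].
  have := lie_linearl (-1) x x' y'; have := lie_linearr (-1) y y' x.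
  rewrite !scaleN1r ![- _ + _]addrC => -> ->.
  by rewrite addrA subrK.
apply: rpredD; [apply: lie_ideall | apply: lie_idealr];
  exact/lie_piP/lie_liftK.
Qed.

Fact lquot_lie_linearl k x y z :
  lquot_lie (k *: x + y) z = k *: lquot_lie x z + lquot_lie y z.
Proof.
rewrite -[x]lie_liftK -[y]lie_liftK -[z]lie_liftK -linearP !lie_pi_lie.
by rewrite lie_linearl linearP.
Qed.

Fact lquot_lie_linearr k x y z :
  lquot_lie z (k *: x + y) = k *: lquot_lie z x + lquot_lie z y.
Proof.
rewrite -[x]lie_liftK -[y]lie_liftK -[z]lie_liftK -linearP !lie_pi_lie.
by rewrite lie_linearr linearP.
Qed.

Fact lquot_lie_xx x : lquot_lie x x = 0.
Proof. by rewrite -[x]lie_liftK lie_pi_lie lie_xx raddf0. Qed.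

Fact lquot_lie_jacobi x y z :
  lquot_lie x (lquot_lie y z) + lquot_lie y (lquot_lie z x)
    + lquot_lie z (lquot_lie x y) = 0.
Proof.
rewrite -[x]lie_liftK -[y]lie_liftK -[z]lie_liftK !lie_pi_lie -!raddfD.
by rewrite lie_jacobi raddf0.
Qed.

HB.instance Definition _ := Lmodule_isLie.Build K lie_quot
  lquot_lie_linearl lquot_lie_linearr lquot_lie_xx lquot_lie_jacobi.

Lemma lie_piE x y : [lie lie_pi x, lie_pi y] = lie_pi [lie x, y].
Proof. exact: lie_pi_lie. Qed.
End LieQuotient.

Section OuterDerivations.
Variables (K : comNzRingType) (A : algType K).

Definition is_derivation (D : A -> A) : Prop :=
  linear D /\ forall x y, D (x * y) = D x * y + x * D y.

Definition derivation : {pred A -> A} := fun D => `[< is_derivation D >].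

Fact derivation_submod_closed : submod_closed derivation.
Proof.
split=> [|k D E]; rewrite !unfold_in.
  apply/asboolP; split=> [k x y|x y].
    by change (0 = k *: (0 : A) + 0); rewrite scaler0 addr0.
  by change (0 = 0 * y + x * 0); rewrite mul0r mulr0 addr0.
move=> /asboolP[linD derD] /asboolP[linE derE]; apply/asboolP; split.
  move=> j x y.
  change (k *: D (j *: x + y) + E (j *: x + y)
    = j *: (k *: D x + E x) + (k *: D y + E y)).
  rewrite linD linE !scalerDr !scalerA [j * k]mulrC.
  by rewrite addrACA.
move=> x y.
change (k *: D (x * y) + E (x * y)
  = (k *: D x + E x) * y + x * (k *: D y + E y)).
rewrite derD derE !scalerDr mulrDl mulrDr -!scalerAl -!scalerAr.
by rewrite addrACA.
Qed.

HB.instance Definition _ :=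
  GRing.isSubmodClosed.Build K (A -> A) derivation derivation_submod_closed.

Record Der : Type := MkDer { der_fun :> A -> A; derP : der_fun \in derivation }.

HB.instance Definition _ := [isSub for der_fun].
HB.instance Definition _ := [Choice of Der by <:].
HB.instance Definition _ := [SubChoice_isSubLmodule of Der by <:].

Lemma der_linear (D : Der) : linear D.
Proof. by case: D => D /= /asboolP[]. Qed.
HB.instance Definition _ (D : Der) :=
  GRing.isLinear.Build K A A *:%R D (der_linear D).

Lemma derM (D : Der) x y : D (x * y) = D x * y + x * D y.
Proof. by move: x y; case: D => D /= /asboolP[]. Qed.

Lemma derE (D E : Der) k x : (k *: D + E) x = k *: D x + E x.
Proof. by []. Qed.

Lemma der_ext (D E : Der) : D =1 E -> D = E.
Proof. by move=> eqDE; apply: val_inj; apply: funext. Qed.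

Fact der_lie_subproof (D E : Der) :
  (fun x => D (E x) - E (D x)) \in derivation.
Proof.
apply/asboolP; split=> [k x y|x y].
  by rewrite !der_linear scalerBr opprD addrACA.
rewrite !derM ?(raddfD D) ?(raddfD E) /= !derM mulrBl mulrBr ?opprD !addrA.
by rewrite (ACl (1*5*4*8*2*7*3*6))%AC /= !addrK.
Qed.

Definition der_lie (D E : Der) : Der := MkDer (der_lie_subproof D E).

Fact der_lie_linearl k (x y z : Der) :
  der_lie (k *: x + y) z = k *: der_lie x z + der_lie y z.
Proof.
apply: der_ext => u.
change (k *: x (z u) + y (z u) - z (k *: x u + y u)
  = k *: (x (z u) - z (x u)) + (y (z u) - z (y u))).
rewrite der_linear.
by rewrite scalerBr opprD addrACA.
Qed.

Fact der_lie_linearr k (x y z : Der) :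
  der_lie z (k *: x + y) = k *: der_lie z x + der_lie z y.
Proof.
apply: der_ext => u.
change (z (k *: x u + y u) - (k *: x (z u) + y (z u))
  = k *: (z (x u) - x (z u)) + (z (y u) - y (z u))).
rewrite der_linear.
by rewrite scalerBr opprD addrACA.
Qed.

Fact der_lie_xx (x : Der) : der_lie x x = 0.
Proof. by apply: der_ext => u; rewrite /= subrr. Qed.

Fact der_lie_jacobi (x y z : Der) :
  der_lie x (der_lie y z) + der_lie y (der_lie z x)
    + der_lie z (der_lie x y) = 0.
Proof.
apply: der_ext => u.
change (x (y (z u) - z (y u)) - (y (z (x u)) - z (y (x u)))
  + (y (z (x u) - x (z u)) - (z (x (y u)) - x (z (y u))))
  + (z (x (y u) - y (x u)) - (x (y (z u)) - y (x (z u)))) = 0).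
rewrite (raddfB x) (raddfB y) (raddfB z).
exact: jacobi_cancel.
Qed.

HB.instance Definition _ := Lmodule_isLie.Build K Der
  der_lie_linearl der_lie_linearr der_lie_xx der_lie_jacobi.

Definition inner_derivation : {pred Der} :=
  fun D => `[< exists a : A, forall x, D x = a * x - x * a >].

Fact inner_submod_closed : submod_closed inner_derivation.
Proof.
split=> [|k D E]; rewrite !unfold_in.
  by apply/asboolP; exists 0 => x; rewrite mul0r mulr0 subrr.
move=> /asboolP[a Da] /asboolP[b Eb]; apply/asboolP.
exists (k *: a + b) => x; rewrite derE Da Eb mulrDl mulrDr -scalerAl -scalerAr.
by rewrite scalerBr opprD addrACA.
Qed.

HB.instance Definition _ :=
  GRing.isSubmodClosed.Build K Der inner_derivation inner_submod_closed.

Fact inner_lie_ideall (D E : Der) :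
  inner_derivation D -> inner_derivation [lie D, E].
Proof.
move=> /asboolP[a Da]; apply/asboolP; exists (- E a) => x /=.
rewrite !Da raddfB /= !derM mulNr mulrN opprK opprB ?opprD !addrA.
by rewrite subrK (ACl (3*2*1*4))%AC /= addrK.
Qed.

Fact inner_lie_idealr (D E : Der) :
  inner_derivation E -> inner_derivation [lie D, E].
Proof.
move=> /asboolP[a Da]; apply/asboolP; exists (D a) => x /=.
rewrite !Da raddfB /= !derM ?opprD !opprK !addrA.
by rewrite (ACl (1*4*2*5*6*3))%AC /= !addrK.
Qed.

HB.instance Definition _ := isLieIdeal.Build K Der inner_derivation
  inner_lie_ideall inner_lie_idealr.

(* HH^1 in degree-one form: derivations modulo inner derivations, with the
   bracket induced by the commutator of derivations. *)
Definition HH1 : Type := lie_quot inner_derivation.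
HB.instance Definition _ := LieAlgebra.on HH1.

Definition der_class (D : Der) : HH1 := lie_pi inner_derivation D.
Fact der_class_linear : linear der_class.
Proof. exact: (linearP (lie_pi inner_derivation)). Qed.
HB.instance Definition _ :=
  GRing.isLinear.Build K Der HH1 *:%R der_class der_class_linear.

Lemma der_class_lie (D E : Der) :
  [lie der_class D, der_class E] = der_class [lie D, E].
Proof. exact: (lie_piE inner_derivation D E). Qed.
End OuterDerivations.

Section PathAlgebra.
Variables (K : comNzRingType) (Q1 : choiceType).

Fact path_alg_scalerAr (k : K) (x y : {malg K[{fmonom Q1}]}) :
  k *: (x * y) = x * (k *: y).
Proof.
apply/malgP => p; rewrite mcoeffZ.
rewrite (mcoeffMl x y) (mcoeffMlw p (finmap.fsubset_refl _) (msuppZ_le k y)).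
rewrite mulr_sumr; apply: eq_bigr => p1 _.
rewrite mulr_sumr; apply: eq_bigr => p2 _.
by rewrite mcoeffZ mulrCA mulrnAr mulrA.
Qed.

(* With a single vertex every word in the loops is a path (the empty word is
   the trivial path at the vertex) and all paths compose, so that the path
   algebra is the algebra of the free monoid on the loops. *)
Definition path_alg : Type := {malg K[{fmonom Q1}]}.
HB.instance Definition _ := GRing.Lalgebra.on path_alg.

HB.instance Definition _ :=
  GRing.Lalgebra_isAlgebra.Build K path_alg path_alg_scalerAr.

Definition path_elt (p : {fmonom Q1}) : path_alg := << p >>.

Definition paths_of_length (n : nat) : set path_alg :=
  [set path_elt p | p in [set p | fdeg p = n]].
End PathAlgebra.

Definition twosided_ideal (A : nzRingType) (S : set A) : Prop :=
  [/\ S 0, forall x y, S x -> S y -> S (x + y),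
      forall a x, S x -> S (a * x) & forall a x, S x -> S (x * a)].

Definition ideal_generated (A : nzRingType) (X : set A) : set A :=
  smallest (@twosided_ideal A) X.

Lemma ideal_generated_ideal (A : nzRingType) (X : set A) :
  twosided_ideal (ideal_generated X).
Proof.
split=> [S [[S0 _ _ _] _] //|x y Ix Iy S SX|a x Ix S SX|a x Ix S SX].
- by case: (SX) => -[_ SD _ _] _; apply: SD; [exact: Ix | exact: Iy].
- by case: (SX) => -[_ _ Sl _] _; apply: Sl; exact: Ix.
- by case: (SX) => -[_ _ _ Sr] _; apply: Sr; exact: Ix.
Qed.

Section RadicalSquareZero.
Variables (K : comNzRingType) (Q1 : choiceType).
Local Notation KQ := (path_alg K Q1).
Implicit Types (p q : {fmonom Q1}) (x y : KQ).

Definition ideal_Q2 : {pred KQ} :=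
  fun x => `[< ideal_generated (@paths_of_length K Q1 2) x >].

Lemma ideal_Q2E x :
  x \in ideal_Q2 <-> forall p, (fdeg p < 2)%N -> x@_p = 0.
Proof.
split=> [/asboolP xI|x0].
  pose S : set KQ := [set x | forall p, (fdeg p < 2)%N -> x@_p = 0].
  apply: (xI S); split; last first.
    move=> _ [p p2 <-] q q2; rewrite mcoeffU.
    by case: eqP p2 q2 => // <- ->.
  split=> [p _|y z Sy Sz p p2|a y Sy p p2|a y Sy p p2].
  - exact: mcoeff0.
  - by rewrite mcoeffD Sy // Sz // addr0.
  - rewrite mcoeffMl big1 // => p1 _; rewrite big1 // => q _.
    case: eqP => [e|_]; last exact: mulr0n.
    rewrite (Sy q) ?mulr0 ?mul0rn //.
    by apply: leq_ltn_trans p2; rewrite -e fdegM leq_addl.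
  - rewrite mcoeffMl big1 // => p1 _; rewrite big1 // => q _.
    case: eqP => [e|_]; last exact: mulr0n.
    rewrite (Sy p1) ?mul0r ?mul0rn //.
    by apply: leq_ltn_trans p2; rewrite -e fdegM leq_addr.
apply/asboolP; have [I0 ID Il Ir] :=
  ideal_generated_ideal (@paths_of_length K Q1 2).
rewrite [x]monalgE; apply: big_ind => // p _.
have [/x0 ->|] := ltnP (fdeg p) 2; first by rewrite monalgU0.
case: p => -[|i [|j s]] //= _; set c := x@_ _.
have -> : << c *g FMonom [:: i, j & s] >> =
   c%:MP * (path_elt K (FMonom [:: i; j]) * path_elt K (FMonom s)) :> KQ.
  rewrite /path_elt !malgM_def !fgmulUU !mulr1 mul1m.
  by congr << _ *g _ >>; apply/eqP; rewrite fmP fmM.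
by apply: Il; apply: Ir => S [_]; apply; exists (FMonom [:: i; j]).
Qed.

Fact ideal_Q2_submod_closed : submod_closed ideal_Q2.
Proof.
split=> [|k x y /ideal_Q2E x0 /ideal_Q2E y0]; apply/ideal_Q2E => p p2.
  exact: mcoeff0.
by rewrite mcoeffD mcoeffZ x0 // y0 // mulr0 addr0.
Qed.

HB.instance Definition _ :=
  GRing.isSubmodClosed.Build K KQ ideal_Q2 ideal_Q2_submod_closed.

Fact ideal_Q2_1N : ideal_Q2 1 = false.
Proof.
apply/negP => /ideal_Q2E/(_ mone); rewrite fdeg1 => /(_ isT) /eqP.
by rewrite mcoeff1 eqxx oner_eq0.
Qed.

Fact ideal_Q2Ml (a x : KQ) : ideal_Q2 x -> ideal_Q2 (a * x).
Proof.
move=> /asboolP xI; apply/asboolP.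
by have [_ _ Il _] := ideal_generated_ideal (@paths_of_length K Q1 2);
  apply: Il.
Qed.

Fact ideal_Q2Mr (a x : KQ) : ideal_Q2 x -> ideal_Q2 (x * a).
Proof.
move=> /asboolP xI; apply/asboolP.
by have [_ _ _ Ir] := ideal_generated_ideal (@paths_of_length K Q1 2);
  apply: Ir.
Qed.

HB.instance Definition _ := isTwoSidedProperIdeal.Build K KQ ideal_Q2
  ideal_Q2_1N ideal_Q2Ml ideal_Q2Mr.

(* The quotient of the path algebra by the ideal generated by the paths of
   length two. *)
Definition rad2_alg : Type := alg_quot ideal_Q2.
HB.instance Definition _ := GRing.Algebra.on rad2_alg.

Definition arrow (c : Q1) : rad2_alg := alg_pi ideal_Q2 (path_elt K (fmu c)).

(* The coefficient of the path p in u, well defined for paths of length < 2. *)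
Definition rcoef (p : {fmonom Q1}) (u : rad2_alg) : K := (alg_lift u : KQ)@_p.

Lemma rcoef_pi p x : (fdeg p < 2)%N -> rcoef p (alg_pi ideal_Q2 x) = x@_p.
Proof.
move=> p2; apply/eqP; rewrite -subr_eq0 -mcoeffB; apply/eqP.
by move: p p2; apply/ideal_Q2E/alg_piP/alg_liftK.
Qed.

Lemma rad2_ext (u v : rad2_alg) :
  (forall p, (fdeg p < 2)%N -> rcoef p u = rcoef p v) -> u = v.
Proof.
move=> uv; rewrite -[u]alg_liftK -[v]alg_liftK; apply/alg_piP/ideal_Q2E.
by move=> p p2; rewrite mcoeffB [_@_p](uv p p2) subrr.
Qed.

Lemma rcoefP p k u v :
  (fdeg p < 2)%N -> rcoef p (k *: u + v) = k * rcoef p u + rcoef p v.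
Proof.
move=> p2; rewrite -[u]alg_liftK -[v]alg_liftK.
by rewrite -(linearP (alg_pi ideal_Q2)) !rcoef_pi // mcoeffD mcoeffZ.
Qed.

Lemma rcoef1M u v : rcoef mone (u * v) = rcoef mone u * rcoef mone v.
Proof.
rewrite -[u]alg_liftK -[v]alg_liftK -(rmorphM (alg_pi ideal_Q2)).
by rewrite !rcoef_pi ?fdeg1 // rmorphM.
Qed.

Lemma mcoeff_sum x p :
  x@_p = \sum_(q <- finmap.enum_fset (msupp x)) x@_q *+ (q == p).
Proof.
rewrite {1}[x]monalgE raddf_sum /=.
by apply: eq_bigr => q _; rewrite mcoeffU.
Qed.

Lemma mcoeffUM x y c :
  (x * y)@_(fmu c) = x@_(fmu c) * y@_mone + x@_mone * y@_(fmu c).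
Proof.
rewrite mcoeffMl !(mcoeff_sum x) !big_distrl -big_split /=.
apply: eq_bigr => p _; rewrite !(mcoeff_sum y) !big_distrr -big_split /=.
apply: eq_bigr => q _; move: (x@_p) (y@_q) => a b.
rewrite !fmP !fmM !fmU !fm1.
case: p q => [[|i [|i' p]]] [[|j [|j' q]]] /=;
  rewrite ?eqseq_cons ?andbT ?andbF;
  by rewrite ?mulr0n ?mulr1n ?mul0r ?mulr0 ?addr0 ?add0r ?mulrnAl ?mulrnAr.
Qed.

Lemma rcoefUM u v c : rcoef (fmu c) (u * v)
  = rcoef (fmu c) u * rcoef mone v + rcoef mone u * rcoef (fmu c) v.
Proof.
rewrite -[u]alg_liftK -[v]alg_liftK -(rmorphM (alg_pi ideal_Q2)).
by rewrite !rcoef_pi ?fdeg1 ?fdegU // mcoeffUM.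
Qed.

Lemma rcoef1_arrow c : rcoef mone (arrow c) = 0.
Proof. by rewrite rcoef_pi ?fdeg1 // mcoeffU fmP fmU fm1. Qed.

Lemma rcoefU_arrow c d : rcoef (fmu c) (arrow d) = (c == d)%:R.
Proof.
by rewrite rcoef_pi ?fdegU // mcoeffU fmP !fmU eqseq_cons andbT eq_sym.
Qed.

Lemma fdeg_lt2 p : (fdeg p < 2)%N -> p = mone \/ exists c, p = fmu c.
Proof.
by case: p => -[|c [|//]] //= _; [left | right; exists c];
  apply/eqP; rewrite fmP ?fm1 ?fmU.
Qed.

Lemma rcoef0 p : (fdeg p < 2)%N -> rcoef p 0 = 0.
Proof.
by move=> p2; rewrite -(raddf0 (alg_pi ideal_Q2)) rcoef_pi // mcoeff0.
Qed.

Lemma rcoefZ p k u : (fdeg p < 2)%N -> rcoef p (k *: u) = k * rcoef p u.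
Proof. by move=> p2; rewrite -[k *: u]addr0 rcoefP // rcoef0 // addr0. Qed.

Lemma arrowMl c u : arrow c * u = rcoef mone u *: arrow c.
Proof.
apply: rad2_ext => p p2; rewrite rcoefZ //.
case: (fdeg_lt2 p2) => [->|[d ->]].
  by rewrite rcoef1M rcoef1_arrow mul0r mulr0.
by rewrite rcoefUM rcoef1_arrow mul0r addr0 mulrC.
Qed.

Lemma arrowMr c u : u * arrow c = rcoef mone u *: arrow c.
Proof.
apply: rad2_ext => p p2; rewrite rcoefZ //.
case: (fdeg_lt2 p2) => [->|[d ->]].
  by rewrite rcoef1M rcoef1_arrow !mulr0.
by rewrite rcoefUM rcoef1_arrow mulr0 add0r.
Qed.

Fact arrow_der_subproof (x y : Q1) :
  (fun u : rad2_alg => rcoef (fmu x) u *: arrow y) \in @derivation K rad2_alg.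
Proof.
apply/asboolP; split=> [k u v|u v].
  by rewrite rcoefP ?fdegU // scalerDl scalerA.
rewrite rcoefUM -scalerAl -scalerAr arrowMl arrowMr !scalerA -scalerDl.
by rewrite (mulrC (rcoef mone u)).
Qed.

Definition arrow_der (x y : Q1) : Der rad2_alg :=
  MkDer (arrow_der_subproof x y).

Lemma arrow_derE (x y z : Q1) :
  arrow_der x y (arrow z) = if z == x then arrow y else 0.
Proof.
by rewrite /= rcoefU_arrow eq_sym; case: eqP; rewrite ?scale1r ?scale0r.
Qed.

(* The class of the derivation of arrow_derE, written (x, y). *)
Definition arrow_pair (x y : Q1) : HH1 rad2_alg := der_class (arrow_der x y).

Lemma arrow_pair_lie (x y z w : Q1) :
  [lie arrow_pair x y, arrow_pair z w]
    = (w == x)%:R *: arrow_pair z y - (y == z)%:R *: arrow_pair x w.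
Proof.
have cZ k (D : Der rad2_alg) : k *: der_class D = der_class (k *: D).
  by rewrite linearZ.
have cB (D E : Der rad2_alg) : der_class D - der_class E = der_class (D - E).
  by rewrite raddfB.
rewrite /arrow_pair der_class_lie !cZ cB; congr (der_class _).
apply: der_ext => u.
change (rcoef (fmu x) (rcoef (fmu z) u *: arrow w) *: arrow y
  - rcoef (fmu z) (rcoef (fmu x) u *: arrow y) *: arrow w
  = (w == x)%:R *: (rcoef (fmu z) u *: arrow y)
    - (y == z)%:R *: (rcoef (fmu x) u *: arrow w)).
have fU (c : Q1) : (fdeg (fmu c) < 2)%N by rewrite fdegU.
rewrite !(rcoefZ _ _ (fU _)) !rcoefU_arrow !scalerA (eq_sym w) (eq_sym y).
rewrite (mulrC (rcoef (fmu z) u)) (mulrC (rcoef (fmu x) u)).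
exact: erefl.
Qed.
End RadicalSquareZero.

Definition two_loops : Type := bool.
HB.instance Definition _ := Choice.on two_loops.
Definition loop_a : two_loops := false.
Definition loop_b : two_loops := true.

(* Main.v *)
Require Import Defs.
From HB Require Import structures.
From mathcomp Require Import all_boot all_order all_algebra.
From mathcomp Require Import boolp classical_sets functions reals.
From mathcomp Require Import complex monalg.

(** Let [A] be the radical-square-zero algebra with one vertex and [n > 1]
    loops, so that [A] has basis [1] and the loops.  A derivation [D] kills [1],
    and it sends loops to combinations of loops: for distinct loops [c] and [d],
    applying [D] to [c * d = 0] and reading off the coefficient of [d] shows
    that [D c] has no constant term ([der_arrow_radical]).  So [D] is the same
    thing as an arbitrary endomorphism of the span of the loops, and the
    commutator of derivations is that of endomorphisms.  As [A] is commutative,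
    inner derivations vanish, and hence the matrix of [D] on the loops
    identifies [HH1 A] with [gl_n] ([HH1_mx_linear], [HH1_mx_lie],
    [HH1_mx_bij]).  All this holds over any commutative ring.

    Traceless matrices thus embed into [HH1 A] as the classes of trace [0]
    ([HH1_sl_embedding]).  When [n] is invertible, splitting off the scalar part
    of a matrix gives [gl_n = sl_n * K] ([HH1_isomorphic_sl]).

    For two loops, matrices having columns indexed by the source [x] of [(x, y)]
    and rows by its target [y], the elements [H], [E], [F] are
    [diag (-1, 1)] and the two off-diagonal matrix units.  They span the
    traceless matrices linearly, and so a fortiori generate them as a Lie
    algebra. *)

Import GRing.Theory Num.Theory.

Local Open Scope classical_set_scope.
Local Open Scope ring_scope.

(** * Matrices *)

(** Scalar matrices are central: this makes [M |-> M - a%:M] compatible with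
    commutators, whatever the scalars. *)
Lemma commutator_sub_scalar (K : comNzRingType) (n : nat) (M N : 'M[K]_n)
    (a b : K) :
  (M - a%:M) *m (N - b%:M) - (N - b%:M) *m (M - a%:M) = M *m N - N *m M.
Proof.
rewrite !mulmxBl !mulmxBr !mul_mx_scalar !mul_scalar_mx !scale_scalar_mx.
rewrite (mulrC b a) !opprB !addrA (ACl (1*8*(2*5)*(3*6)*(4*7)))%AC /=.
by rewrite !addNr subrr !addr0.
Qed.

Lemma ord2P (i : 'I_2) : i = 0 \/ i = 1.
Proof. by case: i => -[|[|//]] i_lt; [left | right]; apply: val_inj. Qed.

Lemma mxtrace2 (K : pzSemiRingType) (M : 'M[K]_2) : \tr M = M 0 0 + M 1 1.
Proof.
rewrite /mxtrace !big_ord_recl big_ord0 addr0.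
by congr (_ + M _ _); apply: val_inj.
Qed.

(** * Derivations of a radical-square-zero algebra as matrices *)

Section DerivationMatrix.
Variables (K : comNzRingType) (Q1 : choiceType) (n : nat) (l : 'I_n -> Q1).
Hypotheses (l_bij : bijective l) (n_gt1 : (1 < n)%N).
Local Notation A := (rad2_alg K Q1).
Implicit Types (u v : A) (D E : Der A) (p q : HH1 A).

Let fdegU_lt2 (c : Q1) : (fdeg (fmu c) < 2)%N.
Proof. by rewrite fdegU. Qed.

Let fdeg1_lt2 : (fdeg (mone : {fmonom Q1}) < 2)%N.
Proof. by rewrite fdeg1. Qed.

Lemma rcoef_sum (w : {fmonom Q1}) (F : 'I_n -> A) : (fdeg w < 2)%N ->
  rcoef w (\sum_i F i) = \sum_i rcoef w (F i).
Proof.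
move=> w2; elim/big_rec2: _ => [|i x y _ <-]; first exact: rcoef0.
by rewrite -{1}[F i]scale1r rcoefP // mul1r.
Qed.

Lemma rcoef_one (w : {fmonom Q1}) : (fdeg w < 2)%N ->
  rcoef w (1 : A) = (w == mone)%:R.
Proof. by move=> w2; rewrite (rcoef_pi 1 w2) mcoeff1. Qed.

Lemma fmu_neq1 (c : Q1) : (fmu c == mone :> {fmonom Q1}) = false.
Proof. by rewrite fmP fmU fm1. Qed.

Lemma rad2_basis u :
  u = rcoef mone u *: 1 + \sum_i rcoef (fmu (l i)) u *: arrow K (l i).
Proof.
have [l' lK l'K] := l_bij.
apply: rad2_ext => w w2; rewrite rcoefP // rcoef_sum // rcoef_one //.
case: (fdeg_lt2 w2) => [->|[c ->]].
  rewrite eqxx mulr1 big1 ?addr0 // => i _.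
  by rewrite rcoefZ // rcoef1_arrow mulr0.
rewrite fmu_neq1 mulr0 add0r (bigD1 (l' c)) //= l'K rcoefZ //.
rewrite rcoefU_arrow eqxx mulr1 big1 ?addr0 // => i ic.
rewrite rcoefZ // rcoefU_arrow; case: eqP => [e|_]; last by rewrite mulr0.
by rewrite e lK eqxx in ic.
Qed.

Lemma der1 D : D 1 = 0.
Proof.
by apply: (@addrI _ (D 1)); rewrite addr0 -{3}[1]mul1r derM mulr1 mul1r.
Qed.

(** With a second loop [d], the coefficient of [d] in
    [0 = D (c * d) = D c * d + c * D d] is the constant term of [D c].  With a
    single loop only [c * c = 0] is available, and it merely shows that twice
    this term is zero. *)
Lemma der_arrow_radical D (c : Q1) : rcoef mone (D (arrow K c)) = 0.
Proof.
have [l' lK _] := l_bij.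
have [d cd] : exists d, c != d.
  have [e|ne] := eqVneq c (l (Ordinal (ltnW n_gt1))).
    exists (l (Ordinal n_gt1)); rewrite e.
    by apply/eqP => /(can_inj lK) [].
  by exists (l (Ordinal (ltnW n_gt1))).
have cd0 : arrow K c * arrow K d = 0.
  by rewrite arrowMl rcoef1_arrow scale0r.
have /(congr1 (rcoef (fmu d))) := derM D (arrow K c) (arrow K d).
rewrite cd0 raddf0 rcoef0 // arrowMr arrowMl.
rewrite rcoefP // rcoefZ // !rcoefU_arrow eqxx mulr1 eq_sym (negPf cd).
by rewrite mulr0 addr0.
Qed.

(** The pair [(x, y)] has its nonzero entry in row [y] and column [x].  Putting
    the source on the columns makes composition of derivations the product of
    matrices in the same order; the transpose would be an anti-morphism. *)
Definition der_mx D : 'M[K]_n :=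
  \matrix_(j, i) rcoef (fmu (l j)) (D (arrow K (l i))).

Lemma der_mx_linear : linear der_mx.
Proof. by move=> k D E; apply/matrixP => j i; rewrite !mxE derE rcoefP. Qed.
HB.instance Definition _ :=
  GRing.isLinear.Build K (Der A) 'M[K]_n *:%R der_mx der_mx_linear.

Lemma der_arrowE D i :
  D (arrow K (l i)) = \sum_j der_mx D j i *: arrow K (l j).
Proof.
rewrite [LHS]rad2_basis der_arrow_radical scale0r add0r.
by apply: eq_bigr => j _; rewrite mxE.
Qed.

Lemma der_mx_inj : injective der_mx.
Proof.
move=> D E DE; apply: der_ext => u; rewrite [u]rad2_basis.
rewrite !der_linear !der1 !scaler0 !add0r (raddf_sum D) (raddf_sum E).
apply: eq_bigr => i _ /=; rewrite (linearZ_LR D) (linearZ_LR E) /=.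
by rewrite !der_arrowE DE.
Qed.

Lemma der_mx_arrow_der x y j i :
  der_mx (arrow_der K x y) j i = ((x == l i) && (y == l j))%:R.
Proof.
rewrite mxE arrow_derE eq_sym; case: eqP => _; last by rewrite rcoef0.
by rewrite rcoefU_arrow eq_sym.
Qed.

Lemma der_mx_surj (M : 'M[K]_n) : exists D, der_mx D = M.
Proof.
have l_inj := bij_inj l_bij.
exists (\sum_i \sum_j M j i *: arrow_der K (l i) (l j)).
apply/matrixP => j i; rewrite raddf_sum summxE (bigD1 i) //=.
rewrite [X in _ + X]big1 ?addr0 => [|i' ii']; last first.
  rewrite raddf_sum summxE big1 // => j' _.
  rewrite /= linearZ /= mxE der_mx_arrow_der (inj_eq l_inj) (negPf ii').
  by rewrite mulr0.
rewrite raddf_sum summxE (bigD1 j) //= big1 ?addr0 => [|j' jj'].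
  by rewrite /= linearZ /= mxE der_mx_arrow_der !eqxx mulr1.
rewrite /= linearZ /= mxE der_mx_arrow_der !(inj_eq l_inj) (negPf jj').
by rewrite andbF mulr0.
Qed.

Lemma der_mx_lie D E :
  der_mx [lie D, E] = der_mx D *m der_mx E - der_mx E *m der_mx D.
Proof.
have comp (D' E' : Der A) j i :
    rcoef (fmu (l j)) (D' (E' (arrow K (l i)))) =
      (der_mx D' *m der_mx E') j i.
  rewrite der_arrowE raddf_sum rcoef_sum // mxE; apply: eq_bigr => k _.
  by rewrite /= linearZ /= rcoefZ // [X in _ = X * _]mxE mulrC.
apply/matrixP => j i; rewrite [RHS]mxE [X in _ + X]mxE -!comp mxE /=.
rewrite [X in _ = X]addrC [X in rcoef _ X = _]addrC -[- E _]scaleN1r.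
by rewrite rcoefP // mulN1r.
Qed.

(** Left and right multiplication by [a] agree on a loop, both being the scaling
    by the constant term of [a]. *)
Lemma inner_derivation_eq0 D : D \in @inner_derivation K A -> D = 0.
Proof.
move=> /asboolP[a Da]; apply: der_mx_inj; rewrite raddf0.
apply/matrixP => j i; rewrite !mxE Da arrowMl arrowMr subrr.
exact: rcoef0.
Qed.

(** * Outer derivations as matrices *)

Lemma lie_lift_class D : lie_lift (der_class D) = D.
Proof.
apply/eqP; rewrite -subr_eq0; apply/eqP/inner_derivation_eq0.
exact/lie_piP/lie_liftK.
Qed.

Definition HH1_mx p : 'M[K]_n := der_mx (lie_lift p).

Lemma HH1_mx_class D : HH1_mx (der_class D) = der_mx D.
Proof. by rewrite /HH1_mx lie_lift_class. Qed.

Lemma HH1_mx_linear : linear HH1_mx.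
Proof.
move=> k p q; rewrite -[p in LHS]lie_liftK -[q in LHS]lie_liftK.
have := linearP (@der_class K A) k (lie_lift p) (lie_lift q).
by move=> <-; rewrite HH1_mx_class linearP.
Qed.

Lemma HH1_mx_lie p q :
  HH1_mx [lie p, q] = HH1_mx p *m HH1_mx q - HH1_mx q *m HH1_mx p.
Proof.
by rewrite -der_mx_lie -HH1_mx_class -der_class_lie /der_class !lie_liftK.
Qed.

Lemma HH1_mx_bij : bijective HH1_mx.
Proof.
have [g gK] := choice der_mx_surj.
exists (fun M => der_class (g M)) => [q|M]; last by rewrite HH1_mx_class gK.
rewrite -[RHS]lie_liftK; congr der_class; exact/der_mx_inj/gK.
Qed.

Lemma HH1_mx_arrow_pair x y j i :
  HH1_mx (arrow_pair K x y) j i = ((x == l i) && (y == l j))%:R.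
Proof. by rewrite HH1_mx_class der_mx_arrow_der. Qed.

Lemma HH1_sl_embedding : exists f : sl K n -> HH1 A,
  [/\ lie_morphism f, injective f & range f = [set q | \tr (HH1_mx q) = 0]].
Proof.
have [g gK Kg] := HH1_mx_bij.
exists (fun M : sl K n => g M); split.
- split=> [k M N|M N]; apply: (can_inj gK).
    by rewrite HH1_mx_linear !Kg.
  by rewrite HH1_mx_lie !Kg.
- by move=> M N /(can_inj Kg)/val_inj.
apply/seteqP; split=> [_ [M _ <-]|q /= /eqP trq].
  by rewrite /= Kg; apply/eqP; exact: sl_mxP M.
by exists (Sl trq) => //; exact: gK.
Qed.

(** Invertibility of [n] lets one correct a matrix by the scalar matrix of the
    same trace; the trace itself, which kills commutators, is the abelian
    factor. *)
Lemma HH1_isomorphic_sl (c : K) : n%:R * c = 1 ->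
  lie_isomorphic (HH1 A) (sl K n * abelian_lie K^o)%type.
Proof.
move=> nc; have [g gK Kg] := HH1_mx_bij.
have sP (M : 'M[K]_n) : M - (c * \tr M)%:M \in @traceless K n.
  rewrite unfold_in raddfB /= mxtrace_scalar -mulr_natl mulrA nc mul1r.
  by rewrite subrr.
exists (fun q => (Sl (sP (HH1_mx q)), \tr (HH1_mx q) : abelian_lie K^o)).
split; last first.
  exists (fun x => g (sl_mx x.1 + (c * x.2)%:M)) => [q|[M t]].
    by rewrite /= subrK gK.
  have trM : \tr (sl_mx M + (c * t)%:M) = t.
    rewrite mxtraceD mxtrace_scalar -mulr_natl mulrA nc mul1r.
    by rewrite (eqP (sl_mxP M)) add0r.
  by congr pair; [apply: val_inj|]; rewrite /= Kg trM // addrK.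
split=> [k p q|p q]; congr pair.
- apply: val_inj => /=; rewrite HH1_mx_linear linearP /= mulrDr mulrCA.
  by rewrite scalerBr scale_scalar_mx addrACA -opprD -raddfD.
- by rewrite /= HH1_mx_linear linearP.
- apply: val_inj => /=; rewrite commutator_sub_scalar HH1_mx_lie.
  by rewrite raddfB /= mxtrace_mulC subrr mulr0 raddf0 subr0.
- by rewrite /= HH1_mx_lie raddfB /= mxtrace_mulC subrr.
Qed.

End DerivationMatrix.

(** * The two loops quiver *)

Theorem proposition4p4 (R : realType) :
  let C := R[i] in
  let A := rad2_alg C two_loops in
  let H : HH1 A := arrow_pair C loop_b loop_b - arrow_pair C loop_a loop_a in
  let E : HH1 A := arrow_pair C loop_a loop_b in
  let F : HH1 A := arrow_pair C loop_b loop_a in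
  (exists f : sl C 2 -> HH1 A,
     [/\ lie_morphism f, injective f &
         range f = lie_generated [set H; E; F]])
  /\ lie_isomorphic (HH1 A) (sl C 2 * abelian_lie C^o)%type.
Proof.
move=> C A H E F.
(* The loops a and b get the indices 0 and 1. *)
pose l (i : 'I_2) : two_loops := i == 1.
have l_bij : bijective l.
  exists (fun b : two_loops => if b then 1 else 0) => [i|[]] //.
  by case: (ord2P i) => ->.
split; last first.
  apply: (@HH1_isomorphic_sl C two_loops 2 l l_bij isT 2^-1).
  by rewrite mulfV // pnatr_eq0.
have [f [f_lie f_inj f_range]] := @HH1_sl_embedding C two_loops 2 l l_bij isT.
exists f; split; rewrite ?f_range {f_range}//.
have m_inj := bij_inj (@HH1_mx_bij C two_loops 2 l l_bij isT).
have mP := @HH1_mx_linear C two_loops 2 l l_bij isT.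
have m_lie := @HH1_mx_lie C two_loops 2 l l_bij isT.
have m_pair := @HH1_mx_arrow_pair C two_loops 2 l l_bij isT.
(* Abstracting [HH1_mx] keeps [mxE] from unfolding its entries. *)
move: (@HH1_mx C two_loops 2 l) m_inj mP m_lie m_pair.
move=> m m_inj mP m_lie m_pair.
have m0 : m 0 = 0 by have := mP (-1) 0 0; rewrite scaler0 addr0 scaleN1r addNr.
have mB p q : m (p - q) = m p - m q.
  by rewrite -scaleN1r addrC mP scaleN1r addrC.
apply/seteqP; split=> [q /= trq|].
  have -> : q = m q 1 1 *: H + (m q 1 0 *: E + m q 0 1 *: F).
    have /eqP : m q 0 0 + m q 1 1 = 0 by rewrite -trq mxtrace2.
    rewrite addr_eq0 => /eqP q00.
    apply: m_inj; rewrite mP -[_ *: F]addr0 !mP m0 mB.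
    apply/matrixP => j i; rewrite !mxE !m_pair.
    case: (ord2P j) (ord2P i) => -> [] -> /=;
      by rewrite ?q00 ?subrr ?sub0r ?subr0 ?mulrN1 ?mulr0 ?mulr1 ?addr0 ?add0r.
  move=> S [[S0 SP _] SX].
  have SZ k x : S x -> S (k *: x).
    by move=> Sx; rewrite -[k *: x]addr0; exact: SP.
  apply/SP; first by apply: SX; left; left.
  by apply/SP; [|apply: SZ]; apply: SX; [left; right | right].
apply: smallest_sub; first split=> [|k p q /= tp tq|p q /= _ _].
- by rewrite /= m0 mxtrace0.
- by rewrite mP linearP /= tp tq mulr0 addr0.
- by rewrite m_lie // raddfB /= mxtrace_mulC subrr.
have trE x y : \tr (m (arrow_pair C x y)) = (x == y)%:R.
  by rewrite mxtrace2 !m_pair; case: x y => -[]; rewrite /= ?addr0 ?add0r.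
by move=> _ [[->|->]|->] /=; rewrite ?mB ?raddfB /= !trE ?subrr.
Qed.
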